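(* For every class $\mathcal{K}$ of fields (including the class of all fields), the class of $\mathcal{K}$-resistant groups (a) is closed under passing to subgroups, (b) is closed under taking direct limits, (c) is closed under taking inverse limits, and (d) is closed under taking ultraproducts.
   Context: For a field $k$, a group $G$ is called $k$-resistant if for every $r$ in the group algebra $k\,G$ with support (set of group elements having nonzero coefficient) of cardinality $>1$, the two-sided ideal of $k\,G$ generated by $r$ is proper. For a class $\mathcal{K}$ of fields, $G$ is $\mathcal{K}$-resistant if it is $k$-resistant for all $k\in\mathcal{K}$. Direct limits and inverse limits are taken over (nonempty) directed, respectively inversely directed, partially ordered sets. *)

(* Defs.v *)
From HB Require Import structures.
From mathcomp Require Import all_boot all_order all_algebra.
From mathcomp Require Import finmap.
From mathcomp Require Import monalg.
From mathcomp Require Import boolp classical_sets filter.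

Set Implicit Arguments.
Unset Strict Implicit.
Unset Printing Implicit Defensive.

Import Order.TTheory GRing.Theory.

Local Open Scope ring_scope.

(* The ring structure that [monalg] puts on [{malg R[M]}] requires a monoid M
   without nontrivial invertible elements, so for a group G the product has to
   be defined separately, on an alias of the R-module [{malg R[G]}] of finitely
   supported functions G -> R. *)
Definition group_algebra (R : nzRingType) (G : groupType) : Type :=
  {malg R[G]}.

HB.instance Definition _ (R : nzRingType) (G : groupType) :=
  GRing.Lmodule.copy (group_algebra R G) {malg R[G]}.

HB.lock Definition gralg_mul (R : nzRingType) (G : groupType)
    (a b : group_algebra R G) : group_algebra R G :=
  \sum_(g <- msupp a) \sum_(h <- msupp b) << a@_g * b@_h *g (g * h)%g >>.

Section GroupAlgebraRing.
Context (R : nzRingType) (G : groupType).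
Local Notation A := (group_algebra R G).
Local Notation gralg_mul := (@gralg_mul R G).
Implicit Types a b c : A.

Definition gralg_one : A := << 1%R *g 1%g >>.

Lemma gralg_mulw (d1 d2 : {fset G}) a b :
    (msupp a `<=` d1)%fset -> (msupp b `<=` d2)%fset ->
  gralg_mul a b =
    \sum_(g <- d1) \sum_(h <- d2) << a@_g * b@_h *g (g * h)%g >>.
Proof.
move=> le_d1 le_d2; rewrite gralg_mul.unlock (big_fset_incl _ le_d1) /=; last first.
  by move=> g _ /mcoeff_outdom ag; rewrite big1 // => h _;
    rewrite ag mul0r monalgU0.
apply/eq_bigr=> g _; apply/big_fset_incl => // h _ /mcoeff_outdom ->.
by rewrite mulr0 monalgU0.
Qed.

Lemma gralg_mulU x y (g h : G) :
  gralg_mul << x *g g >> << y *g h >> = << x * y *g (g * h)%g >>.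
Proof. by rewrite (gralg_mulw msuppU_le msuppU_le) !big_seq_fset1 !mcoeffUU. Qed.

Lemma gralg_mulDl : left_distributive gralg_mul +%R.
Proof.
move=> a b c.
rewrite (gralg_mulw (msuppD_le a b) (fsubset_refl _)).
rewrite (gralg_mulw (fsubsetUl _ (msupp b)) (fsubset_refl (msupp c))).
rewrite (gralg_mulw (fsubsetUr (msupp a) _) (fsubset_refl (msupp c))).
rewrite -big_split /=; apply/eq_bigr=> g _.
rewrite -big_split /=; apply/eq_bigr=> h _.
by rewrite mcoeffD mulrDl monalgUD.
Qed.

Lemma gralg_mulDr : right_distributive gralg_mul +%R.
Proof.
move=> c a b.
rewrite (gralg_mulw (fsubset_refl _) (msuppD_le a b)).
rewrite (gralg_mulw (fsubset_refl (msupp c)) (fsubsetUl _ (msupp b))).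
rewrite (gralg_mulw (fsubset_refl (msupp c)) (fsubsetUr (msupp a) _)).
rewrite -big_split /=; apply/eq_bigr=> g _.
rewrite -big_split /=; apply/eq_bigr=> h _.
by rewrite mcoeffD mulrDr monalgUD.
Qed.

Lemma gralg_mul0l : left_zero 0 gralg_mul.
Proof. by move=> a; rewrite gralg_mul.unlock msupp0 big_seq_fset0. Qed.

Lemma gralg_mul0r : right_zero 0 gralg_mul.
Proof.
by move=> a; rewrite gralg_mul.unlock big1 // => g _; rewrite msupp0 big_seq_fset0.
Qed.

Lemma gralg_mul_suml I (s : seq I) (F : I -> A) b :
  gralg_mul (\sum_(i <- s) F i) b = \sum_(i <- s) gralg_mul (F i) b.
Proof.
exact: (big_morph (gralg_mul^~ b) (fun _ _ => gralg_mulDl _ _ _)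
  (gralg_mul0l b)).
Qed.

Lemma gralg_mul_sumr I (s : seq I) a (F : I -> A) :
  gralg_mul a (\sum_(i <- s) F i) = \sum_(i <- s) gralg_mul a (F i).
Proof.
exact: (big_morph (gralg_mul a) (fun _ _ => gralg_mulDr _ _ _)
  (gralg_mul0r a)).
Qed.

Lemma gralgE a : a = \sum_(g <- msupp a) (<< a@_g *g g >> : A).
Proof. exact: monalgE. Qed.

Lemma gralg_mulA : associative gralg_mul.
Proof.
move=> a b c; rewrite (gralgE a) (gralgE b) (gralgE c).
rewrite !gralg_mul_suml; apply/eq_bigr=> g _.
rewrite !(gralg_mul_sumr _ << a@_g *g g >>) gralg_mul_suml; apply/eq_bigr=> h _.
rewrite !gralg_mul_sumr; apply/eq_bigr=> l _.
by rewrite !gralg_mulU mulrA mulgA.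
Qed.

Lemma gralg_mul1l : left_id gralg_one gralg_mul.
Proof.
move=> a; rewrite (gralgE a) gralg_mul_sumr; apply/eq_bigr=> g _.
by rewrite gralg_mulU mul1r mul1g.
Qed.

Lemma gralg_mul1r : right_id gralg_one gralg_mul.
Proof.
move=> a; rewrite (gralgE a) gralg_mul_suml; apply/eq_bigr=> g _.
by rewrite gralg_mulU mulr1 mulg1.
Qed.

Lemma gralg_one_neq0 : gralg_one != 0.
Proof. by rewrite monalgU_eq0 oner_neq0. Qed.

HB.instance Definition _ := GRing.Zmodule_isNzRing.Build A
  gralg_mulA gralg_mul1l gralg_mul1r gralg_mulDl gralg_mulDr gralg_one_neq0.

Lemma gralg_scaleAl (x : R) (a b : A) : x *: (a * b) = (x *: a) * b.
Proof.
have xU (y : R) (g : G) : x *: (<< y *g g >> : A) = << x * y *g g >>.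
  by apply/malgP=> k; rewrite mcoeffZ !mcoeffU mulrnAr.
rewrite (gralgE a) (gralgE b) scaler_sumr !mulr_suml scaler_sumr.
apply/eq_bigr=> g _; rewrite !mulr_sumr scaler_sumr; apply/eq_bigr=> h _.
by rewrite xU !(gralg_mulU _ _ _ _ : _ * _ = _) xU mulrA.
Qed.

HB.instance Definition _ := GRing.Lmodule_isLalgebra.Build R A gralg_scaleAl.

End GroupAlgebraRing.

Local Open Scope classical_set_scope.

Definition two_sided_ideal (A : nzRingType) (J : set A) : Prop :=
  [/\ J 0,
      forall a b, J a -> J b -> J (a + b),
      forall a b, J b -> J (a * b)
    & forall a b, J a -> J (a * b)].

Definition ideal_generated (A : nzRingType) (r : A) : set A :=
  smallest (@two_sided_ideal A) [set r].

Definition resistant_over (k : fieldType) (G : groupType) : Prop :=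
  forall r : group_algebra k G,
    (1 < #|` msupp r|)%N -> ideal_generated r <> setT.

Definition resistant (K : fieldType -> Prop) (G : groupType) : Prop :=
  forall k : fieldType, K k -> resistant_over k G.

Local Open Scope order_scope.

Definition up_directed (d : Order.disp_t) (I : porderType d) : Prop :=
  inhabited I /\ forall i j : I, exists l : I, i <= l /\ j <= l.

Definition down_directed (d : Order.disp_t) (I : porderType d) : Prop :=
  inhabited I /\ forall i j : I, exists l : I, l <= i /\ l <= j.

(* A functor from the poset I to groups. It serves both for direct systems (I
   directed upwards) and for inverse systems (I directed downwards, so that the
   maps of an inverse system also go from smaller to larger indices). *)
Record group_system (d : Order.disp_t) (I : porderType d) := GroupSystem {
  gs_obj :> I -> groupType;
  gs_map : forall i j : I, i <= j -> {multiplicative gs_obj i -> gs_obj j};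
  gs_map_id : forall (i : I) (ii : i <= i) x, gs_map ii x = x;
  gs_map_comp : forall (i j l : I) (ij : i <= j) (jl : j <= l) (il : i <= l) x,
    gs_map jl (gs_map ij x) = gs_map il x
}.

Section Limits.
Context (d : Order.disp_t) (I : porderType d) (D : group_system I).

Definition is_cocone (H : groupType) (f : forall i, {multiplicative D i -> H})
    : Prop :=
  forall (i j : I) (ij : i <= j) x, f j (gs_map D ij x) = f i x.

Definition is_direct_limit (L : groupType)
    (q : forall i, {multiplicative D i -> L}) : Prop :=
  [/\ up_directed I,
      is_cocone q
    & forall (H : groupType) (f : forall i, {multiplicative D i -> H}),
        is_cocone f ->
        exists u : {multiplicative L -> H},
          (forall i x, u (q i x) = f i x) /\
          (forall v : {multiplicative L -> H},
             (forall i x, v (q i x) = f i x) -> v =1 u)].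

Definition is_cone (H : groupType) (f : forall i, {multiplicative H -> D i})
    : Prop :=
  forall (i j : I) (ij : i <= j) x, gs_map D ij (f i x) = f j x.

Definition is_inverse_limit (L : groupType)
    (p : forall i, {multiplicative L -> D i}) : Prop :=
  [/\ down_directed I,
      is_cone p
    & forall (H : groupType) (f : forall i, {multiplicative H -> D i}),
        is_cone f ->
        exists u : {multiplicative H -> L},
          (forall i x, p i (u x) = f i x) /\
          (forall v : {multiplicative H -> L},
             (forall i x, p i (v x) = f i x) -> v =1 u)].

End Limits.

Section Ultraproduct.
Context (I : Type) (U : set_system I) (UU : UltraFilter U) (G : I -> groupType).

Definition ultra_eq (x y : forall i, G i) : bool :=
  `[< U [set i | x i = y i] >].

Lemma ultra_eq_is_equiv : equiv_class_of ultra_eq.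
Proof.
split=> [x|x y|y x z].
- by apply/asboolP; apply: filterS filterT => i _.
- by apply/asboolP/asboolP; apply: filterS => i /= ->.
- move=> /asboolP xy /asboolP yz; apply/asboolP.
  by apply: filterS2 xy yz => i /= -> ->.
Qed.

Canonical ultra_eq_equiv := EquivRelPack ultra_eq_is_equiv.

Local Open Scope quotient_scope.

Definition ultraproduct : Type := {eq_quot ultra_eq_equiv}.

HB.instance Definition _ := Choice.on ultraproduct.
HB.instance Definition _ := EqQuotient.on ultraproduct.

Lemma ultraP (x y : forall i, G i) :
  \pi_ultraproduct x = \pi_ultraproduct y <-> U [set i | x i = y i].
Proof. by split=> [/eqmodP/asboolP|xy]; last apply/eqmodP/asboolP. Qed.

Definition ultra_one : ultraproduct := \pi_ultraproduct (fun i => 1%g).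
Definition ultra_inv := lift_op1 ultraproduct
  (fun (x : forall i, G i) i => (x i)^-1)%g.
Definition ultra_mul := lift_op2 ultraproduct
  (fun (x y : forall i, G i) i => x i * y i)%g.

Lemma ultra_repr (x : forall i, G i) :
  U [set i | repr (\pi_ultraproduct x) i = x i].
Proof. by apply/ultraP; rewrite reprK. Qed.

Lemma ultra_pi_mul (x y : forall i, G i) :
  ultra_mul (\pi_ultraproduct x) (\pi_ultraproduct y) =
  \pi_ultraproduct (fun i => x i * y i)%g.
Proof.
by unlock ultra_mul; apply/ultraP; apply: filterS2 (ultra_repr x) (ultra_repr y) => i /= -> ->.
Qed.

Lemma ultra_pi_inv (x : forall i, G i) :
  ultra_inv (\pi_ultraproduct x) = \pi_ultraproduct (fun i => (x i)^-1)%g.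
Proof. by unlock ultra_inv; apply/ultraP; apply: filterS (ultra_repr x) => i /= ->. Qed.

Lemma ultra_mulA : associative ultra_mul.
Proof.
move=> x y z; elim/quotW: x => x; elim/quotW: y => y; elim/quotW: z => z; rewrite !ultra_pi_mul.
by apply/ultraP; apply: filterS filterT => i _ /=; rewrite mulgA.
Qed.

Lemma ultra_mul1 : left_id ultra_one ultra_mul.
Proof.
move=> x; elim/quotW: x => x; rewrite ultra_pi_mul.
by apply/ultraP; apply: filterS filterT => i _ /=; rewrite mul1g.
Qed.

Lemma ultra_mul1r : right_id ultra_one ultra_mul.
Proof.
move=> x; elim/quotW: x => x; rewrite ultra_pi_mul.
by apply/ultraP; apply: filterS filterT => i _ /=; rewrite mulg1.
Qed.

Lemma ultra_mulV : left_inverse ultra_one ultra_inv ultra_mul.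
Proof.
move=> x; elim/quotW: x => x; rewrite ultra_pi_inv ultra_pi_mul.
by apply/ultraP; apply: filterS filterT => i _ /=; rewrite mulVg.
Qed.

Lemma ultra_mulVr : right_inverse ultra_one ultra_inv ultra_mul.
Proof.
move=> x; elim/quotW: x => x; rewrite ultra_pi_inv ultra_pi_mul.
by apply/ultraP; apply: filterS filterT => i _ /=; rewrite mulgV.
Qed.

HB.instance Definition _ := isGroup.Build ultraproduct
  ultra_mulA ultra_mul1 ultra_mul1r ultra_mulV ultra_mulVr.

End Ultraproduct.

(* Main.v *)
Require Import Defs.
From HB Require Import structures.
From mathcomp Require Import all_boot all_order all_algebra.
From mathcomp Require Import finmap monalg.
From mathcomp Require Import boolp classical_sets filter.

(** A failure of resistance of a group [L] consists of an element [r] with two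
    distinct points in its support and of one equation
    [\sum_i a_i * r * b_i = 1]. This involves only finitely many group elements
    and finitely many products of these. A map of sets from [L] to a group [G]
    that respects these products, and separates the two points from the rest of
    the support, therefore carries the failure from [L] to [G].

    All four closure properties come from the resulting criterion
    [resistant_filter]: [L] is resistant if there are resistant groups [G i] and
    maps [phi i : L -> G i] which, along a proper filter on the indices, are
    eventually multiplicative at each pair of elements and eventually separate
    each pair of distinct elements. For a group embedded in [G], take the
    embedding, over a single index. For an ultraproduct, take the evaluation at
    [i] of chosen representatives, along the ultrafilter. For an inverse limit,
    take the projections, along the filter of lower sections; they separate
    points by the uniqueness half of the universal property
    ([inverse_limit_inj]).

    A direct limit embeds in the ultraproduct of the system along any
    ultrafilter that contains the upper sections: an element of [D i] has germ
    given by its images in the [D j], [i <= j]. By the existence half of the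
    universal property these germs induce a homomorphism on the limit, and it is
    injective because the limit is the union of the images of the [D i]
    ([direct_limit_surj]) and elements with equal germs already agree in some
    [D l]. *)

Set Implicit Arguments.
Unset Strict Implicit.
Unset Printing Implicit Defensive.

Import Order.TTheory GRing.Theory.

Local Open Scope classical_set_scope.
Local Open Scope ring_scope.

(** * Maps between group algebras induced by maps of sets *)

Section Transport.
Context (R : nzRingType).
Implicit Types G H : groupType.

(** The linear extension of [phi], for an arbitrary map [phi]: it is a ring
    morphism only as far as [phi] is multiplicative. *)
Definition gralg_map G H (phi : G -> H) (a : group_algebra R G) :
    group_algebra R H :=
  \sum_(g <- msupp a) << a@_g *g phi g >>.

Section Additivity.
Context G H (phi : G -> H).
Implicit Types a b : group_algebra R G.

Lemma gralg_mapEw (d : {fset G}) a : (msupp a `<=` d)%fset ->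
  gralg_map phi a = \sum_(g <- d) << a@_g *g phi g >>.
Proof.
move=> ad; rewrite /gralg_map (big_fset_incl _ ad) // => g _ /mcoeff_outdom ->.
by rewrite monalgU0.
Qed.

Lemma gralg_map0 : gralg_map phi 0 = 0.
Proof. by rewrite /gralg_map msupp0 big_seq_fset0. Qed.

Lemma gralg_mapD : {morph gralg_map phi : a b / a + b}.
Proof.
move=> a b.
rewrite (gralg_mapEw (msuppD_le a b)) (gralg_mapEw (fsubsetUl _ (msupp b))).
rewrite (gralg_mapEw (fsubsetUr (msupp a) _)) -big_split /=.
by apply: eq_bigr => g _; rewrite mcoeffD monalgUD.
Qed.

Lemma gralg_mapU c g : gralg_map phi << c *g g >> = << c *g phi g >>.
Proof. by rewrite (gralg_mapEw msuppU_le) big_seq_fset1 mcoeffUU. Qed.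

Lemma gralg_map1 : phi 1%g = 1%g -> gralg_map phi 1 = 1.
Proof. by move=> phi1; rewrite [LHS]gralg_mapU phi1. Qed.

(** Only the products of elements of the two supports matter, so
    multiplicativity of [phi] on finitely many pairs is enough. *)
Lemma gralg_mapM a b :
    {in msupp a & msupp b, {morph phi : g h / (g * h)%g}} ->
  gralg_map phi (a * b) = gralg_map phi a * gralg_map phi b.
Proof.
move=> phiM; rewrite [a * b](gralg_mulw (fsubset_refl _) (fsubset_refl _)).
rewrite (big_morph _ gralg_mapD gralg_map0) mulr_suml; apply: eq_big_seq => g ag.
rewrite (big_morph _ gralg_mapD gralg_map0) mulr_sumr; apply: eq_big_seq => h bh.
by rewrite gralg_mapU phiM // [RHS]gralg_mulU.
Qed.

(** No other point of the support of [a] is merged with [g], so nothing is added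
    to its coefficient. *)
Lemma mcoeff_gralg_map a g :
    {in msupp a, forall h, phi h = phi g -> h = g} ->
  (gralg_map phi a)@_(phi g) = a@_g.
Proof.
move=> phi_inj; rewrite /gralg_map raddf_sum /=.
have phi_out h : h \in msupp a -> h != g -> << a@_h *g phi h >>@_(phi g) = 0.
  move=> ah; rewrite mcoeffU; case: (phi h =P phi g) => [/(phi_inj h ah) ->|//].
  by rewrite eqxx.
have [ag|/[dup] ag /mcoeff_outdom ->] := boolP (g \in msupp a).
  rewrite (bigD1_seq g) ?fset_uniq //= mcoeffUU big_seq_cond big1 ?addr0 // => h.
  by case/andP; apply: phi_out.
rewrite big_seq big1 // => h ah; apply: phi_out => //.
by apply: contraNneq ag => <-.
Qed.

End Additivity.
End Transport.

(** * The filter criterion *)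

Lemma ideal_generatedP (A : nzRingType) (r : A) :
  two_sided_ideal (ideal_generated r) /\ ideal_generated r r.
Proof.
split; last by move=> J [_]; apply.
split=> [J [[]]//|a b Ja Jb J JP|a b Jb J JP|a b Ja J JP];
  have [[_ jD jl jr] _] := JP.
- by apply: jD; [apply: Ja|apply: Jb].
- by apply: jl; apply: Jb.
- by apply: jr; apply: Ja.
Qed.

Section FilterCriterion.
Context (I : Type) (F : set_system I) (FF : ProperFilter F).
Context (L : groupType) (G : I -> groupType) (phi : forall i, L -> G i).
Hypothesis phiM :
  forall x y, F [set i | phi i (x * y)%g = (phi i x * phi i y)%g].
Hypothesis phi_sep : forall x y, x <> y -> F [set i | phi i x <> phi i y].

Lemma near_gralg_mapM (R : nzRingType) (a b : group_algebra R L) :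
  F [set i | gralg_map (phi i) (a * b) =
             gralg_map (phi i) a * gralg_map (phi i) b].
Proof.
have FD : F (\bigcap_(g in [set` msupp a]) \bigcap_(h in [set` msupp b])
    [set i | phi i (g * h)%g = (phi i g * phi i h)%g]).
  by apply: filter_bigI => g _; apply: filter_bigI.
apply: filterS FD => i phiMi /=; apply: gralg_mapM => g h ag bh.
exact: phiMi.
Qed.

Lemma near_mcoeff_gralg_map (R : nzRingType) (a : group_algebra R L) g :
  F [set i | (gralg_map (phi i) a)@_(phi i g) = a@_g].
Proof.
have FD : F (\bigcap_(h in [set` msupp a])
    [set i | phi i h = phi i g -> h = g]).
  apply: filter_bigI => h _; have [->|/eqP hg] := eqVneq h g.
    by apply: filterS filterT.
  by apply: filterS (phi_sep hg) => i ne /ne.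
by apply: filterS FD => i inj_i; apply: mcoeff_gralg_map => h; apply: inj_i.
Qed.

(** Instead of writing 1 as a combination of elements [a * r * b], one considers
    the set [J] of those [s] whose image eventually lies in the ideal generated by
    the image of [r]. Since [gralg_map (phi i)] is additive and eventually
    multiplicative at any given pair, [J] is a two-sided ideal containing [r].
    If 1 were in the ideal generated by [r], it would be in [J], and some [G i]
    would fail to be resistant. *)
Lemma resistant_over_filter (k : fieldType) :
  (forall i, resistant_over k (G i)) -> resistant_over k L.
Proof.
move=> Gres r r_gt1 rT.
pose J : set (group_algebra k L) :=
  [set s | F [set i | ideal_generated (gralg_map (phi i) r)
                                      (gralg_map (phi i) s)]].
have J_ideal : two_sided_ideal J.
  split=> [|a b Ja Jb|a b Jb|a b Ja]; rewrite /J /=.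
  - apply: filterS filterT => i _ /=; rewrite gralg_map0.
    by have [[? _ _ _] _] := ideal_generatedP (gralg_map (phi i) r).
  - apply: filterS2 Ja Jb => i /= Ja Jb; rewrite gralg_mapD.
    by have [[_ jD _ _] _] := ideal_generatedP (gralg_map (phi i) r); apply: jD.
  - apply: filterS2 Jb (near_gralg_mapM a b) => i /= Jb ->.
    by have [[_ _ jl _] _] := ideal_generatedP (gralg_map (phi i) r); apply: jl.
  - apply: filterS2 Ja (near_gralg_mapM a b) => i /= Ja ->.
    by have [[_ _ _ jr] _] := ideal_generatedP (gralg_map (phi i) r); apply: jr.
have J1 : J 1.
  have : ideal_generated r 1 by rewrite rT.
  apply: smallest_sub => // _ ->; rewrite /J /=; apply: filterS filterT => i _.
  by have [] := ideal_generatedP (gralg_map (phi i) r).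
(* phi i 1 is eventually idempotent in the group G i. *)
have near1 : F [set i | phi i 1%g = 1%g].
  apply: filterS (phiM 1%g 1%g) => i /=; rewrite mulg1 => e.
  by apply: (@mulgI _ (phi i 1%g)); rewrite -e mulg1.
have [g [h [gr hr gh]]] :
    exists g h, [/\ g \in msupp r, h \in msupp r & g <> h].
  rewrite cardfE in r_gt1; have /card_gt1P [g [h [_ _ gh]]] := r_gt1.
  exists (val g), (val h); split; [exact: valP|exact: valP|].
  by apply/eqP.
have [i [[[[J1i e1] eg] eh] ghi]] := filter_ex (filterI (filterI (filterI
  (filterI J1 near1) (near_mcoeff_gralg_map r g)) (near_mcoeff_gralg_map r h))
  (phi_sep gh)).
apply: (Gres i (gralg_map (phi i) r)).
  have <- : #|` [fset phi i g; phi i h]%fset| = 2%N.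
    by rewrite cardfs2; have /eqP -> := ghi.
  apply/fsubset_leq_card/fsubsetP => x; rewrite !inE => /orP[]/eqP->;
    by rewrite -mcoeff_neq0 ?eg ?eh mcoeff_neq0.
have [[_ _ jl _] _] := ideal_generatedP (gralg_map (phi i) r).
apply/seteqP; split=> // s _; rewrite -[s]mulr1; apply: jl.
by move: J1i; rewrite /= gralg_map1.
Qed.

Lemma resistant_filter (K : fieldType -> Prop) :
  (forall i, resistant K (G i)) -> resistant K L.
Proof. by move=> Gres k Kk; apply: resistant_over_filter => i; apply: Gres. Qed.

End FilterCriterion.

(** * Subgroups and ultraproducts *)

Lemma resistant_embedding (K : fieldType -> Prop) (H G : groupType)
    (f : {multiplicative H -> G}) :
  injective f -> resistant K G -> resistant K H.
Proof.
move=> f_inj Gres.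
apply: (@resistant_filter unit (globally setT)
  (@globally_properfilter unit setT tt I) H (fun=> G) (fun=> f)) => [x y|x y xy|//].
- by move=> _ _ /=; rewrite gmulfM.
- by move=> _ _ /= /f_inj.
Qed.

Lemma resistant_ultraproduct (K : fieldType -> Prop) (I : Type)
    (U : set_system I) (UU : UltraFilter U) (G : I -> groupType) :
  (forall i, resistant K (G i)) -> resistant K (ultraproduct UU G).
Proof.
apply: (@resistant_filter I U _ (ultraproduct UU G) G
  (fun i (x : ultraproduct UU G) => repr x i)) => x y.
  apply/(ultraP UU); by rewrite reprK -ultra_pi_mul !reprK.
(* Here the filter has to be ultra: representatives of distinct elements are not
   merely not eventually equal, but eventually distinct. *)
move=> xy; have [|//] := in_ultra_setVsetC [set i | repr x i = repr y i] UU.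
by move/(ultraP UU); rewrite !reprK.
Qed.

(** * Subgroups cut out by a predicate *)

Section SubgroupType.
Context (G : groupType) (P : set G).

Definition subgroup_pred (x : G) : bool := `[< P x >].

(** The closure proofs are parameters so that the group structure can be inferred
    from the type. *)
Definition subgroup_type (P1 : P 1%g)
    (PF : forall x y, P x -> P y -> P (x / y)%g) : Type :=
  {x : G | subgroup_pred x}.

Context (P1 : P 1%g) (PF : forall x y, P x -> P y -> P (x / y)%g).

Lemma subgroup_pred_closed : group_closed subgroup_pred.
Proof.
split=> [|x y /asboolP Px /asboolP Py]; apply/asboolP; first exact: P1.
exact: PF.
Qed.

HB.instance Definition _ := SubChoice.on (subgroup_type P1 PF).
HB.instance Definition _ := SubChoice_isSubGroup.Build G subgroup_pred
  (subgroup_type P1 PF) subgroup_pred_closed.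

Lemma subgroup_typeP (x : subgroup_type P1 PF) : P (val x).
Proof. exact: asboolW (valP x). Qed.

End SubgroupType.

Section Corestriction.
Context (G H : groupType) (P : set G) (P1 : P 1%g).
Context (PF : forall x y, P x -> P y -> P (x / y)%g).
Context (f : {multiplicative H -> G}) (Pf : forall x, P (f x)).

Definition corestriction (x : H) : subgroup_type P1 PF :=
  exist _ (f x) (asboolT (Pf x)).

Fact corestriction_gmulfM : {morph corestriction : x y / (x * y)%g}.
Proof. by move=> x y; apply: val_inj; rewrite /= gmulfM. Qed.

HB.instance Definition _ := monoid.isMultiplicative.Build H (subgroup_type P1 PF)
  corestriction corestriction_gmulfM.

End Corestriction.

(** * Consequences of the universal properties *)

Lemma gmulf_group1 (G H : groupType) (f : {multiplicative G -> H}) :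
  f 1%g = 1%g.
Proof. by apply: (@mulgI _ (f 1%g)); rewrite -gmulfM !mulg1. Qed.

Lemma gmulf_groupV (G H : groupType) (f : {multiplicative G -> H}) x :
  f x^-1%g = (f x)^-1%g.
Proof.
by apply: (@mulgI _ (f x)); rewrite -gmulfM !mulgV gmulf_group1.
Qed.

Local Open Scope order_scope.

Section Limits.
Context (d : Order.disp_t) (I : porderType d) (D : group_system I).
Context (L : groupType).

(** The union [P] of the images is a subgroup by directedness. The universal
    property gives [u : L -> P]; composed with the inclusion of [P] it fixes each
    [q i y], so by uniqueness it is the identity of [L]. *)
Lemma direct_limit_surj (q : forall i : I, {multiplicative D i -> L}) x :
  is_direct_limit q -> exists i y, q i y = x.
Proof.
move=> [[[i0] dir] cocone_q univ].
pose P : set L := [set x | exists i y, q i y = x].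
have P1 : P 1%g by exists i0, 1%g; apply: gmulf_group1.
have PF x1 x2 : P x1 -> P x2 -> P (x1 / x2)%g.
  move=> [i1 [y1 <-]] [i2 [y2 <-]]; have [l [i1l i2l]] := dir i1 i2.
  exists l, (gs_map D i1l y1 / gs_map D i2l y2)%g.
  by rewrite gmulfM gmulf_groupV !cocone_q.
have Pq i y : P (q i y) by exists i, y.
have [] := univ _ (fun i => corestriction P1 PF (Pq i)).
  by move=> i j ij y; apply: val_inj; rewrite /= cocone_q.
move=> u [uq _].
have [w [_ w_uniq]] := univ L q cocone_q.
have valu y : val (u y) = y.
  rewrite [LHS](w_uniq (val \o u : {multiplicative L -> L})) => [|i z /=].
    by rewrite -(w_uniq (idfun : {multiplicative L -> L})).
  by rewrite uq.
by rewrite -[x]valu; apply: (subgroup_typeP (u x)).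
Qed.

(** On the common kernel of the projections, the inclusion into [L] and the
    trivial morphism induce the same cone, so they coincide. *)
Lemma inverse_limit_inj (p : forall i : I, {multiplicative L -> D i}) x y :
  is_inverse_limit p -> (forall i, p i x = p i y) -> x = y.
Proof.
move=> [_ cone_p univ] pxy.
pose P : set L := [set z | forall i, p i z = 1%g].
have P1 : P 1%g by move=> i; apply: gmulf_group1.
have PF x1 x2 : P x1 -> P x2 -> P (x1 / x2)%g.
  by move=> Px1 Px2 i; rewrite gmulfM gmulf_groupV Px1 Px2 divgg.
have Pxy : P (x / y)%g by move=> i; rewrite gmulfM gmulf_groupV pxy divgg.
pose H : groupType := subgroup_type P1 PF.
have [i j ij t|w [_ w_uniq]] := univ H
  (fun i => one_fun (D i) : {multiplicative H -> D i}).
  exact: (gmulf_group1 (gs_map D ij)).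
pose z : H := exist _ (x / y)%g (asboolT Pxy).
apply/divg1_eq; rewrite -[LHS]/(val z).
rewrite [LHS](w_uniq (val : {multiplicative H -> L})) => [|i t].
  by rewrite -(w_uniq (one_fun L : {multiplicative H -> L})).
exact: (subgroup_typeP t i).
Qed.

End Limits.

(** * Direct and inverse limits *)

Lemma tail_properfilter (I : Type) (R : I -> I -> Prop) :
  inhabited I -> (forall i, R i i) -> (forall i j l, R i j -> R j l -> R i l) ->
  (forall i j, exists l, R i l /\ R j l) ->
  ProperFilter (filter_from setT R).
Proof.
move=> [i0] Rxx Rtr Rdir; apply: filter_from_proper; last by move=> i _; exists i.
apply: filter_from_filter => [|i j _ _]; first by exists i0.
by have [l [il jl]] := Rdir i j; exists l => // x lx; split; apply: Rtr lx.
Qed.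

Section DirectLimitEmbedding.
Context (d : Order.disp_t) (I : porderType d) (D : group_system I).
Context (U : set_system I) (UU : UltraFilter U).
Hypothesis U_tail : forall i : I, U [set j | i <= j].

(** The value 1 outside the upper section of [i] is arbitrary: upper sections
    belong to [U]. *)
Definition germ_rep (i : I) (x : D i) (j : I) : D j :=
  if pselect (i <= j) is left ij then gs_map D ij x else 1%g.

Lemma germ_repE (i : I) (x : D i) (j : I) (ij : i <= j) :
  germ_rep x j = gs_map D ij x.
Proof.
by rewrite /germ_rep; case: pselect => // ij'; rewrite (Prop_irrelevance ij ij').
Qed.

Definition germ (i : I) (x : D i) : ultraproduct UU D :=
  (\pi_(ultraproduct UU D) (germ_rep x))%qT.

Lemma germP (i j : I) (x : D i) (y : D j) :
  germ x = germ y <-> U [set l | germ_rep x l = germ_rep y l].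
Proof. exact: ultraP. Qed.

Fact germ_gmulfM (i : I) : {morph @germ i : x y / (x * y)%g}.
Proof.
move=> x y; rewrite /germ [RHS]ultra_pi_mul; apply/ultraP.
by apply: filterS (U_tail i) => j /= ij; rewrite !germ_repE gmulfM.
Qed.

HB.instance Definition _ i := monoid.isMultiplicative.Build (D i) (ultraproduct UU D)
  (@germ i) (@germ_gmulfM i).

Lemma germ_cocone : is_cocone (fun i => @germ i : {multiplicative _ -> _}).
Proof.
move=> i j ij x; apply/germP; apply: filterS (U_tail j) => l /= jl.
by rewrite (germ_repE _ jl) (germ_repE _ (le_trans ij jl))
  (gs_map_comp _ _ (le_trans ij jl)).
Qed.

Lemma direct_limit_embeds (L : groupType)
    (q : forall i : I, {multiplicative D i -> L}) :
  is_direct_limit q ->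
  exists u : {multiplicative L -> ultraproduct UU D}, injective u.
Proof.
move=> Lq; have [[_ dir] cocone_q univ] := Lq.
have [u [uq _]] := univ _ _ germ_cocone; exists u.
move=> x1 x2; have [i1 [y1 <-]] := direct_limit_surj x1 Lq.
have [i2 [y2 <-]] := direct_limit_surj x2 Lq.
rewrite !uq => /germP e12.
have [l [[/= e i1l] i2l]] :=
  filter_ex (filterI (filterI e12 (U_tail i1)) (U_tail i2)).
by rewrite -(cocone_q _ _ i1l) -(cocone_q _ _ i2l) -!germ_repE e.
Qed.

End DirectLimitEmbedding.

Lemma resistant_direct_limit (K : fieldType -> Prop) (d : Order.disp_t)
    (I : porderType d) (D : group_system I) (L : groupType)
    (q : forall i : I, {multiplicative D i -> L}) :
  is_direct_limit q -> (forall i, resistant K (D i)) -> resistant K L.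
Proof.
move=> Lq Dres; have [[I0 dir] _ _] := Lq.
have tailF : ProperFilter (filter_from setT (fun i j : I => i <= j)).
  by apply: tail_properfilter => // i j l; apply: le_trans.
have [U [UU tailU]] := ultraFilterLemma tailF.
have U_tail i : U [set j | i <= j] by apply: tailU; exists i.
have [u u_inj] := direct_limit_embeds UU U_tail Lq.
by apply: (resistant_embedding u_inj); apply: resistant_ultraproduct.
Qed.

Lemma resistant_inverse_limit (K : fieldType -> Prop) (d : Order.disp_t)
    (I : porderType d) (D : group_system I) (L : groupType)
    (p : forall i : I, {multiplicative L -> D i}) :
  is_inverse_limit p -> (forall i, resistant K (D i)) -> resistant K L.
Proof.
move=> Lp; have [[I0 dir] cone_p _] := Lp.
have tailF : ProperFilter (filter_from setT (fun i j : I => j <= i)).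
  apply: tail_properfilter => // i j l ji lj; exact: le_trans lj ji.
apply: (resistant_filter tailF (phi := fun i => p i)) => x y.
  by apply: filterS filterT => i _ /=; rewrite gmulfM.
move=> xy; have [i pixy] : exists i, p i x <> p i y.
  by apply: contrapT => /forallNP pxy; apply/xy/(inverse_limit_inj Lp) => i;
    apply: contrapT; apply: pxy.
exists i => // j /= ji pjxy; apply: pixy.
by rewrite -!(cone_p _ _ ji) pjxy.
Qed.

Theorem corollary16 (K : fieldType -> Prop) :
  [/\ forall (G : groupType) (S : pred G) (H : subGroupType S),
        resistant K G -> resistant K H,
      forall (d : Order.disp_t) (I : porderType d) (D : group_system I)
          (L : groupType) (q : forall i : I, {multiplicative D i -> L}),
        is_direct_limit q ->
        (forall i : I, resistant K (D i)) -> resistant K L,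
      forall (d : Order.disp_t) (I : porderType d) (D : group_system I)
          (L : groupType) (p : forall i : I, {multiplicative L -> D i}),
        is_inverse_limit p ->
        (forall i : I, resistant K (D i)) -> resistant K L
    & forall (I : Type) (U : set_system I) (UU : UltraFilter U)
          (G : I -> groupType),
        (forall i : I, resistant K (G i)) -> resistant K (ultraproduct UU G)].
Proof.
split.
- move=> G S H.
  exact: (@resistant_embedding K H G (val : {multiplicative H -> G}) val_inj).
- exact: resistant_direct_limit.
- exact: resistant_inverse_limit.
- exact: resistant_ultraproduct.
Qed.
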